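(* Let $0<\lambda,\delta<1$. If a stationary MPE path has a mixed (non-pure) accumulation point $p$, then every $x\in z^*(p)$ has at least two maximizing pure evaluators, i.e. $|\arg\max_{j\in J}u_j(x)|\ge2$, and every $i\in J$ with $p^i>0$ satisfies $u_i(x)=\max_{j\in J}u_j(x)$. For fixed finite $J$ and $X$, the set of payoff arrays $u=(u_j(x))_{j\in J,x\in X}\in\mathbb R^{|J||X|}$ admitting a stationary MPE with a path that does not converge to a pure worldview has empty interior in $\mathbb R^{|J||X|}$ and is contained in $$\bigcup_{x\in X}\ \bigcup_{i<j}\{u:u_i(x)=u_j(x)\}.$$ In particular, there is no nonempty open set of payoff arrays such that for each array in it a stationary MPE with a path not converging to a pure worldview exists.
   Context: $J=\{1,\ldots,n\}$ and $X$ are nonempty finite sets (pure worldviews and actions) with payoffs $u_j(x)\in\mathbb R$. $\Delta^n=\{\alpha\in\mathbb R^n:\alpha^j\ge0,\ \sum_j\alpha^j=1\}$; $\alpha(j)$, the vertex with weight one on $j$, are the pure worldviews. $U(\alpha,x)=\sum_j\alpha^ju_j(x)$, $z^*(\alpha)=\arg\max_{x\in X}U(\alpha,x)$. A stationary pure strategy is a pair of arbitrary maps $\phi:\Delta^n\to\Delta^n$, $z:\Delta^n\to X$ (no continuity or measurability assumed). With $\phi^k$ the $k$-fold iterate, $$C_{\phi,z}(\beta;\alpha)=\sum_{k=0}^\infty\delta^k\big[(1-\lambda)U(\phi^k(\beta),z(\phi^k(\beta)))+\lambda U(\alpha,z(\phi^k(\beta)))\big].$$ A stationary MPE is a pair $(\phi,z)$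 such that for every $\alpha$: $z(\alpha)\in z^*(\alpha)$, and $C_{\phi,z}(\phi(\alpha);\alpha)\ge C_{\phi,z}(\beta;\alpha)$ for every $\beta\in\Delta^n$. A stationary MPE path is a sequence $\alpha_{t+1}=\phi(\alpha_t)$, $x_t=z(\alpha_t)$ from some $\alpha_0\in\Delta^n$. *)

(* Defs.v *)
From mathcomp Require Import all_boot all_order all_algebra.
From mathcomp Require Import all_classical all_reals all_analysis.
Import Order.TTheory GRing.Theory Num.Theory.
Import numFieldNormedType.Exports.

Set Implicit Arguments.
Unset Strict Implicit.
Unset Printing Implicit Defensive.

Local Open Scope classical_set_scope.
Local Open Scope ring_scope.

(* Worldviews are row vectors and the pure ones are indexed by 'I_n, shifting
   J = {1, ..., n} to {0, ..., n-1}.  A payoff array u_j(x) is a point u (j, x)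
   of R^(J x X), whose finite product topology is that of {ptws _ -> _}. *)

Definition simplex (R : realType) (n : nat) : set 'rV[R]_n :=
  [set a | (forall j, 0 <= a 0 j) /\ \sum_(j < n) a 0 j = 1].
Arguments simplex : clear implicits.

Definition pure (R : realType) (n : nat) (j : 'I_n) : 'rV[R]_n :=
  delta_mx 0 j.

Definition argmax (R : realType) (T : finType) (f : T -> R) : {set T} :=
  [set x : T | [forall y : T, f y <= f x]]%SET.

Section Game.
Context {R : realType} {n : nat} {X : finType}.
Implicit Types (u : {ptws 'I_n * X -> R}) (lambda delta : R).
Implicit Types (phi : simplex R n -> simplex R n) (z : simplex R n -> X).

Definition utility u (a : 'rV[R]_n) (x : X) : R :=
  \sum_(j < n) a 0 j * u (j, x).

Definition zstar u (a : 'rV[R]_n) : {set X} := argmax (utility u a).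

Definition continuation lambda delta u phi z (b a : simplex R n) : R :=
  limn [series let bk := iter k phi b in
          delta ^+ k * ((1 - lambda) * utility u (\val bk) (z bk)
                        + lambda * utility u (\val a) (z bk))]_k.

Definition stationary_MPE lambda delta u phi z : Prop :=
  forall a : simplex R n,
    z a \in zstar u (\val a) /\
    forall b : simplex R n,
      continuation lambda delta u phi z b a
        <= continuation lambda delta u phi z (phi a) a.

Definition stationary_path phi z (a : nat -> simplex R n) (x : nat -> X) :
    Prop :=
  forall t, a t.+1 = phi (a t) /\ x t = z (a t).

Definition stationary_MPE_path lambda delta u
    (a : nat -> simplex R n) (x : nat -> X) : Prop :=
  exists phi z, stationary_MPE lambda delta u phi z /\ stationary_path phi z a x.

(* Limits are taken in R^n; since the simplex is closed, this agrees with
   taking them in the simplex. *)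
Definition accumulation_point (a : nat -> simplex R n) (p : 'rV[R]_n) : Prop :=
  cluster ((fun t => \val (a t)) @ \oo) p.

Definition converges_to_pure (a : nat -> simplex R n) : Prop :=
  exists j : 'I_n, (fun t => \val (a t)) @ \oo --> pure R j.

End Game.

Definition nonpure_payoffs (R : realType) (n : nat) (X : finType)
    (lambda delta : R) : set {ptws 'I_n * X -> R} :=
  [set u | exists a x, stationary_MPE_path lambda delta u a x /\
                       ~ converges_to_pure a].
Arguments nonpure_payoffs {R} n X lambda delta.

(* Main.v *)
Require Import Defs.
From mathcomp Require Import all_boot all_order all_algebra.
From mathcomp Require Import all_classical all_reals all_analysis.
From mathcomp Require Import ring lra.
Import Order.TTheory GRing.Theory Num.Theory.
Import numFieldNormedType.Exports.
Local Open Scope classical_set_scope.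
Local Open Scope ring_scope.

(* Let [m a] be the utility of the action chosen at [a] and [P a] the
   equilibrium continuation value at [a]. Optimality of [phi] gives
   [m a <= (1 - delta) P a <= (1 - lambda) m (phi a) + lambda U (a, z (phi a))],
   so [m] increases along paths and [(1 - delta) P p = m p] at every
   accumulation point [p]: staying at [p] forever is optimal. A small deviation from [p]
   towards a pure worldview [j] must then be unprofitable, which forces
   [u_j(x) <= U (p, x)] for every [x] optimal at [p]. Without ties
   [u_i(x) = u_j(x)] all accumulation points are therefore pure, and a limit of
   consecutive points of the path shows that it cannot jump infinitely often
   between two of them. *)

(** * Linear forms on the simplex *)

Section WeightedSum.
Set Implicit Arguments.
Unset Strict Implicit.
Context {R : realType} {n : nat}.
Implicit Types (w : 'I_n -> R) (a b : 'rV[R]_n).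

(** Utilities, total mass and, up to a constant, continuation values as functions of the evaluator
    all have this form. *)
Definition weighted_sum w a : R := \sum_(j < n) a 0 j * w j.

Lemma weighted_sum_continuous w : continuous (weighted_sum w).
Proof.
have coordM j : continuous (fun a : 'rV[R]_n => a 0 j * w j).
  move=> a; apply: (@continuousM R 'rV[R]_n _ (fun=> w j)).
    exact: coord_continuous.
  exact: cst_continuous.
apply: continuous_big => [|j _]; last exact: coordM.
exact: (@pseudometric_normed_Zmodule.add_continuous R R).
Qed.

Lemma weighted_sum1 a : \sum_(j < n) a 0 j = weighted_sum (fun=> 1) a.
Proof. by apply: eq_bigr => j _; rewrite mulr1. Qed.

Lemma weighted_sum_segment w a b (s : R) :
  weighted_sum w ((1 - s) *: a + s *: b)
  = (1 - s) * weighted_sum w a + s * weighted_sum w b.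
Proof.
rewrite /weighted_sum !mulr_sumr -big_split/=; apply: eq_bigr => j _.
by rewrite !mxE; ring.
Qed.

Lemma weighted_sumZ w (c : R) a :
  weighted_sum (fun j => c * w j) a = c * weighted_sum w a.
Proof.
by rewrite /weighted_sum mulr_sumr; apply: eq_bigr => j _; rewrite mulrCA.
Qed.

Lemma weighted_sumB w w' a :
  weighted_sum (fun j => w j - w' j) a = weighted_sum w a - weighted_sum w' a.
Proof.
by rewrite /weighted_sum -sumrB; apply: eq_bigr => j _; rewrite mulrBr.
Qed.

Lemma weighted_sum_pure w (j : 'I_n) : weighted_sum w (pure R j) = w j.
Proof.
rewrite /weighted_sum (bigD1 j)//= big1 => [|i /negPf ij].
  by rewrite !mxE !eqxx mul1r addr0.
by rewrite !mxE ij andbF mul0r.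
Qed.

Lemma simplex_pure (j : 'I_n) : simplex R n (pure R j).
Proof.
split=> [i|]; first by rewrite mxE ler0n.
by rewrite weighted_sum1 weighted_sum_pure.
Qed.

Lemma simplex_segment a b (s : R) : simplex R n a -> simplex R n b ->
  0 <= s <= 1 -> simplex R n ((1 - s) *: a + s *: b).
Proof.
move=> [a0 a1] [b0 b1] /andP[s0 s1]; split=> [j|].
  by rewrite !mxE addr_ge0// mulr_ge0 ?subr_ge0.
by rewrite weighted_sum1 weighted_sum_segment -!weighted_sum1 a1 b1; ring.
Qed.

Lemma simplex_le1 a (j : 'I_n) : simplex R n a -> a 0 j <= 1.
Proof.
move=> [a0 <-]; rewrite (bigD1 j)//= lerDl sumr_ge0// => i _; exact: a0.
Qed.

Lemma closed_weighted_sum_le w (c : R) : closed [set a | weighted_sum w a <= c].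
Proof.
apply: (@preimage_closed _ _ (weighted_sum w) [set x | x <= c]).
  by move=> a _; exact: weighted_sum_continuous.
exact: closed_le.
Qed.

Lemma closed_weighted_sum_ge w (c : R) : closed [set a | c <= weighted_sum w a].
Proof.
apply: (@preimage_closed _ _ (weighted_sum w) [set x | c <= x]).
  by move=> a _; exact: weighted_sum_continuous.
exact: closed_ge.
Qed.

(** Serves limits of pairs of consecutive worldviews. *)
Lemma closed_weighted_sum_pair (w w' : 'I_n -> R) :
  closed [set v : 'rV[R]_n * 'rV[R]_n |
    weighted_sum w v.1 <= weighted_sum w' v.2].
Proof.
pose f (v : 'rV[R]_n * 'rV[R]_n) := weighted_sum w v.1 - weighted_sum w' v.2.
have -> : [set v | weighted_sum w v.1 <= weighted_sum w' v.2]
    = f @^-1` [set x | x <= 0].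
  by apply/seteqP; split=> v; rewrite /f/= subr_le0.
apply: preimage_closed; last exact: closed_le.
move=> v _; apply: cvgB.
  apply: (@continuous_comp _ _ _ fst (weighted_sum w)); first exact: cvg_fst.
  exact: weighted_sum_continuous.
apply: (@continuous_comp _ _ _ snd (weighted_sum w')); first exact: cvg_snd.
exact: weighted_sum_continuous.
Qed.

Lemma simplex_closed : closed (simplex R n).
Proof.
have -> : simplex R n =
    (\bigcap_(j in [set: 'I_n]) [set a : 'rV[R]_n | 0 <= a 0 j])
    `&` [set a : 'rV[R]_n | weighted_sum (fun=> 1) a = 1].
  apply/seteqP; split=> a; rewrite /simplex/= weighted_sum1 => -[a0 a1];
    split=> //.
    by move=> j _; exact: a0.
  by move=> j; exact: a0.
apply: closedI.
  apply: closed_bigI => j _.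
  apply: (@preimage_closed _ _ (fun a : 'rV[R]_n => a 0 j) [set x | 0 <= x]).
    by move=> a _; exact: coord_continuous.
  exact: closed_ge.
apply: (@preimage_closed _ _ (weighted_sum (fun=> 1)) [set x | x = 1]).
  by move=> a _; exact: weighted_sum_continuous.
exact: closed_eq.
Qed.

Lemma simplex_compact : compact (simplex R n).
Proof.
have cube_compact : compact [set a : 'rV[R]_n | forall j, a ord0 j \in `[0, 1]].
  apply: (@rV_compact _ _ (fun=> `[0 : R, 1]%classic)) => _.
  exact: segment_compact.
apply: subclosed_compact simplex_closed cube_compact _.
move=> a sa j /=; rewrite in_itv/= simplex_le1// andbT.
by case: sa => + _; apply.
Qed.

Lemma weighted_sum_le w a (c : R) : simplex R n a ->
  (forall j, w j <= c) -> weighted_sum w a <= c.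
Proof.
move=> [a0 a1] wc; rewrite -[c]mul1r -a1 mulr_suml.
by apply: ler_sum => j _; exact: ler_wpM2l.
Qed.

(** The weighted sum of the nonnegative gaps [weighted_sum w a - w j] is zero, so every gap of
    positive weight vanishes. *)
Lemma support_argmax w a (i : 'I_n) : simplex R n a ->
  (forall j, w j <= weighted_sum w a) -> 0 < a 0 i -> w i = weighted_sum w a.
Proof.
move=> [a0 a1] wa ai.
have : \sum_(j < n) a 0 j * (weighted_sum w a - w j) = 0.
  under eq_bigr do rewrite mulrBr.
  by rewrite big_split/= sumrN -mulr_suml a1 mul1r subrr.
move/eqP; rewrite psumr_eq0 => [/allP/(_ i)|j _].
  by rewrite mem_index_enum mulf_eq0 gt_eqF//= subr_eq0 => /(_ isT)/eqP.
by rewrite mulr_ge0// subr_ge0.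
Qed.

Lemma simplex_support a : simplex R n a -> exists i, 0 < a 0 i.
Proof.
move=> [a0 a1]; apply: contrapT => /forallNP a_le0.
suff /eqP : (1 : R) = 0 by rewrite oner_eq0.
rewrite -a1 big1// => j _; apply/le_anti; rewrite a0 andbT leNgt.
by apply/negP; exact: a_le0.
Qed.

Lemma simplex_support1 a (k : 'I_n) : simplex R n a ->
  (forall i, 0 < a 0 i -> i = k) -> a = pure R k.
Proof.
move=> [a0 a1] supp.
have aj j : j != k -> a 0 j = 0.
  move=> /eqP jk; apply/le_anti; rewrite a0 andbT leNgt.
  by apply/negP => /supp.
apply/rowP => j; rewrite mxE eqxx/=; have [->|/aj//] := eqVneq j k.
by rewrite -a1 (bigD1 k)//= big1 ?addr0.
Qed.

(** The whole support attains the maximum of [w], which injectivity allows at one index only. *)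
Lemma argmax_pure w a : injective w -> simplex R n a ->
  (forall j, w j <= weighted_sum w a) ->
  exists2 k, a = pure R k & w k = weighted_sum w a.
Proof.
move=> w_inj sa wa; have [k ak] := simplex_support sa.
have wk := support_argmax sa wa ak.
exists k => //; apply: simplex_support1 => // i ai.
by apply: w_inj; rewrite wk; exact: support_argmax.
Qed.

(** The norm is the maximum norm, and coordinate [i] alone contributes 1. *)
Lemma norm_pureB (i j : 'I_n) : i != j -> 1 <= `|pure R i - pure R j|.
Proof.
move=> ij; rewrite {1}/Num.norm/= mx_normrE.
apply: le_trans (le_bigmax _ _ (0, i)).
by rewrite !mxE !eqxx (negPf ij) subr0 normr1.
Qed.

End WeightedSum.

(** * Discounted series *)

Section DiscountedSum.
Set Implicit Arguments.
Unset Strict Implicit.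
Context {R : realType} (delta : R) (delta01 : 0 < delta < 1).
Implicit Types (w : nat -> R).

Lemma cvg_discounted_sum w (B : R) : (forall k, `|w k| <= B) ->
  cvgn [series delta ^+ k * w k]_k.
Proof.
move=> wB; have /andP[d0 d1] := delta01.
have B0 : 0 <= B by apply: le_trans (wB 0%N).
apply: normed_cvg.
apply: (@series_le_cvg _ _ (geometric B delta)) => [k|k|k|].
- exact: normr_ge0.
- by rewrite /= mulr_ge0// exprn_ge0// ltW.
- rewrite /= normrM ger0_norm ?exprn_ge0 ?(ltW d0)// mulrC.
  by rewrite ler_wpM2r// exprn_ge0// ltW.
- by apply: is_cvg_geometric_series; rewrite gtr0_norm.
Qed.

Lemma discounted_sumS w : cvgn [series delta ^+ k * w k.+1]_k ->
  limn [series delta ^+ k * w k]_k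
  = w 0%N + delta * limn [series delta ^+ k * w k.+1]_k.
Proof.
move=> cw; apply: cvg_lim => //; rewrite -cvg_shiftS.
have -> : [sequence [series delta ^+ k * w k]_k n.+1]_n
    = (fun n => w 0%N + delta * [series delta ^+ k * w k.+1]_k n).
  apply/funext => n; rewrite /= !seriesEord/= big_ord_recl expr0 mul1r.
  congr (_ + _); rewrite mulr_sumr; apply: eq_bigr => k _.
  by rewrite exprS mulrA.
by apply: cvgD; [exact: cvg_cst|apply: cvgM => //; exact: cvg_cst].
Qed.

End DiscountedSum.

(** Takes the place of extracting convergent subsequences. *)
Lemma cluster_closed (T : topologicalType) (F : set_system T)
    (A : set T) (p : T) :
  cluster F p -> closed A -> F A -> A p.
Proof.
by rewrite clusterE => Fp cA FA; have := Fp A FA; rewrite -(closure_id A).1.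
Qed.

(** * Second differences of a real function *)

Section Halving.
Set Implicit Arguments.
Unset Strict Implicit.
Context {R : realType}.

(* The difference quotients of [g] at [0] would drop by at least [c / 2] at
   each halving of the step, yet they are bounded below by [K]. *)
Lemma halving_absurd (g : R -> R) (c K : R) : 0 < c ->
  (forall s, 0 < s <= 2^-1 -> c * s <= g (2 * s) + g 0 - 2 * g s) ->
  (forall s, 0 <= s <= 1 -> g 0 + s * K <= g s) -> False.
Proof.
move=> c0 drop bound.
pose q k := 2 ^+ k * (g (2 ^- k) - g 0).
have pow_gt0 k : 0 < 2 ^+ k :> R by rewrite exprn_gt0.
have pow_ge1 k : 1 <= 2 ^+ k :> R by rewrite exprn_ege1// ler1n.
have q_drop k : q k.+1 <= q k - c / 2.
  have s0 : 0 < 2 ^- k.+1 :> R by rewrite invr_gt0.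
  have sE : 2 * 2 ^- k.+1 = 2 ^- k :> R.
    by rewrite exprS invfM mulrA divff ?mul1r.
  have : 0 < (2 ^- k.+1 : R) <= 2^-1.
    by rewrite s0 exprS invfM ler_piMr ?invr_ge0// invf_le1.
  (* Scaled by [2 ^+ k], the second difference is exactly [q k - q k.+1]. *)
  move=> /drop; rewrite sE => /(ler_wpM2l (ltW (pow_gt0 k))).
  have -> : 2 ^+ k * (c * 2 ^- k.+1) = c / 2.
    by rewrite exprS; field; rewrite gt_eqF.
  rewrite /q exprS; lra.
have q_le k : q k <= q 0%N - k%:R * (c / 2).
  elim: k => [|k IH]; first by rewrite mul0r subr0.
  by have := q_drop k; rewrite -[k.+1%:R]natr1; lra.
have q_ge k : K <= q k.
  have s01 : 0 <= (2 ^- k : R) <= 1 by rewrite invr_ge0 ltW//= invf_le1.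
  have := ler_wpM2l (ltW (pow_gt0 k)) (bound _ s01).
  have -> : 2 ^+ k * (g 0 + 2 ^- k * K) = 2 ^+ k * g 0 + K.
    by field; rewrite gt_eqF.
  by rewrite /q; lra.
have [k] : exists k : nat, (q 0%N - K) / (c / 2) < k%:R.
  by eexists; apply: le_lt_trans (ler_norm _) (archi_boundP (normr_ge0 _)).
rewrite ltr_pdivrMr ?divr_gt0// => lt_k.
by have := le_trans (q_ge k) (q_le k); lra.
Qed.

End Halving.

(** * Continuation values and equilibrium inequalities *)

Section Equilibrium.
Set Implicit Arguments.
Unset Strict Implicit.
Context {R : realType} {n : nat} {X : finType} (lambda delta : R).
Context (lambda01 : 0 < lambda < 1) (delta01 : 0 < delta < 1).
Context (u : {ptws 'I_n * X -> R}).
Context (phi : simplex R n -> simplex R n) (z : simplex R n -> X).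
Implicit Types (a b : simplex R n) (x : X).

Let C := continuation lambda delta u phi z.

Lemma simplexP a : simplex R n (\val a).
Proof. exact: set_mem (valP a). Qed.

Lemma utilityE (v : 'rV[R]_n) x :
  utility u v x = weighted_sum (fun j => u (j, x)) v.
Proof. by []. Qed.

Lemma payoff_bounded : exists B : R, forall j x, `|u (j, x)| <= B.
Proof.
exists (\sum_jx `|u jx|) => j x.
by rewrite (bigD1 (j, x))//= lerDl sumr_ge0.
Qed.

Lemma utility_bounded : exists B : R, forall a x, `|utility u (\val a) x| <= B.
Proof.
have [B uB] := payoff_bounded; exists B => a x.
rewrite utilityE ler_norml; apply/andP; split.
  rewrite lerNl -[leLHS]mulN1r /weighted_sum mulr_sumr.
  under eq_bigr do rewrite mulN1r -mulrN.
  apply: weighted_sum_le (simplexP a) _ => j.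
  by rewrite lerNl; have /ler_normlP[] := uB j x; rewrite lerNl.
apply: weighted_sum_le (simplexP a) _ => j.
exact: le_trans (ler_norm _) (uB j x).
Qed.

Definition flow_payoff b a : R :=
  (1 - lambda) * utility u (\val b) (z b) + lambda * utility u (\val a) (z b).

(** The first period is split off: the start advances to [phi b], the evaluator [a] stays. *)
Lemma continuation_step b a :
  C b a = flow_payoff b a + delta * C (phi b) a.
Proof.
rewrite /C /continuation.
pose w k := flow_payoff (iter k phi b) a.
have wS k : w k.+1 = flow_payoff (iter k phi (phi b)) a by rewrite /w iterSr.
have -> : (fun k => let bk := iter k phi (phi b) in
    delta ^+ k * ((1 - lambda) * utility u (\val bk) (z bk)
                        + lambda * utility u (\val a) (z bk)))
    = (fun k => delta ^+ k * w k.+1) by apply/funext => k; rewrite wS.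
rewrite -/(w 0%N) -discounted_sumS//.
have [B uB] := utility_bounded.
apply: (@cvg_discounted_sum _ _ delta01 _ (B + B)) => k.
have /andP[/ltW l0 /ltW l1] := lambda01.
rewrite wS /flow_payoff (le_trans (ler_normD _ _))// lerD// normrM.
  by rewrite ger0_norm ?subr_ge0// -[leRHS]mul1r ler_pM// ?subr_ge0// gerBl.
by rewrite ger0_norm// -[leRHS]mul1r ler_pM.
Qed.

(** For a fixed start [b] the evaluator enters each period affinely. This gives regularity in [a]
    although [phi] and [z] are arbitrary. *)
Lemma continuation_affine b : exists (V : R) (w : 'I_n -> R),
  forall a, C b a = V + weighted_sum w (\val a).
Proof.
have [B uB] := payoff_bounded; have [B' UB] := utility_bounded.
pose bk k := iter k phi b.
pose v := [series delta ^+ k * utility u (\val (bk k)) (z (bk k))]_k.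
pose s j := [series delta ^+ k * u (j, z (bk k))]_k.
have cv : cvgn v by apply: (cvg_discounted_sum delta01 (B := B')).
have cs j : cvgn (s j) by apply: (cvg_discounted_sum delta01 (B := B)).
exists ((1 - lambda) * limn v), (fun j => lambda * limn (s j)) => a.
apply: cvg_lim => //.
have -> : [series let bk := iter k phi b in
          delta ^+ k * ((1 - lambda) * utility u (\val bk) (z bk)
                        + lambda * utility u (\val a) (z bk))]_k
   = (fun N => (1 - lambda) * v N
               + \sum_(j < n) (\val a) 0 j * (lambda * s j N)).
  apply/funext => N; rewrite /v /s !seriesEord/= mulr_sumr.
  under [X in _ = _ + X]eq_bigr do rewrite seriesEord/= mulrA mulr_sumr.
  rewrite exchange_big/= -big_split/=; apply: eq_bigr => k _.
  rewrite mulrDr mulrCA; congr (_ + _).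
  rewrite /utility !mulr_sumr; apply: eq_bigr => j _; rewrite -/(bk k).
  by ring.
have cM (c : R) (f : nat -> R) l :
    f @ \oo --> l -> c * f N @[N --> \oo] --> c * l.
  by move=> fl; apply: cvgM => //; exact: cvg_cst.
apply: cvgD; first exact: cM.
apply: cvg_big => [|j _]; last by do 2 apply: (cM).
exact: (@pseudometric_normed_Zmodule.add_continuous R R).
Qed.

Context (mpe : stationary_MPE lambda delta u phi z).

(** [worth] and [value] are the [m] and [P] of the overview. *)
Definition worth a : R := utility u (\val a) (z a).
Definition value a : R := C (phi a) a.

Lemma utility_le_worth a x : utility u (\val a) x <= worth a.
Proof. by have [+ _] := mpe a; rewrite inE => /forallP; apply. Qed.

Lemma zstar_worth a x : x \in zstar u (\val a) ->
  utility u (\val a) x = worth a.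
Proof.
by rewrite inE => /forallP xmax; apply/le_anti; rewrite utility_le_worth xmax.
Qed.

Lemma continuation_le_value b a : C b a <= value a.
Proof. by have [_] := mpe a; apply. Qed.

(** The deviation to [a] itself pays [worth a] now and [value a] from the next period on. *)
Lemma worth_le_value a : worth a <= (1 - delta) * value a.
Proof.
have := continuation_le_value a a.
rewrite continuation_step /flow_payoff -/(value a) -/(worth a); lra.
Qed.

(** Skipping a step by moving straight to [phi (phi a)] must not pay. *)
Lemma value_le_flow a : (1 - delta) * value a <= flow_payoff (phi a) a.
Proof.
have /andP[d0 _] := delta01.
have := ler_wpM2l (ltW d0) (continuation_le_value (phi (phi a)) a).
have : value a = flow_payoff (phi a) a + delta * C (phi (phi a)) a.
  exact: continuation_step.
lra.
Qed.

(** Chain the two previous bounds and replace the utility of [z (phi a)] at [a] by [worth a]; a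
    common factor [1 - lambda > 0] remains. *)
Lemma worth_nondecreasing a : worth a <= worth (phi a).
Proof.
have /andP[l0 l1] := lambda01.
have := le_trans (worth_le_value a) (value_le_flow a); rewrite /flow_payoff.
have := utility_le_worth a (z (phi a)); rewrite -/(worth (phi a)); nra.
Qed.

Lemma value_le_worth a : (1 - delta) * value a <= worth (phi a).
Proof.
have /andP[l0 l1] := lambda01.
have := value_le_flow a; rewrite /flow_payoff -/(worth (phi a)).
have := utility_le_worth a (z (phi a)); have := worth_nondecreasing a; nra.
Qed.

(* Staying put is optimal at [p], so [p] cannot gain from deviating to
   [p_s = (1 - s) p + s e_j]. Bounding that deviation from below only uses
   [f p = 2 f p_s - f p_2s] for affine [f], and gives for
   [g s = lambda * worth p_s + delta * value p_s] the second difference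
   estimate refuted by [halving_absurd]. *)
Lemma stay_optimal_argmax p x :
  (1 - delta) * value p <= worth p -> x \in zstar u (\val p) ->
  forall j, u (j, x) <= utility u (\val p) x.
Proof.
move=> stay xp j; rewrite leNgt; apply/negP => gain.
have [/andP[l0 l1] /andP[d0 d1]] := (lambda01, delta01).
(* Where the point leaves the simplex, [seg] falls back to [p]. *)
pose seg (s : R) : simplex R n :=
  insubd p ((1 - s) *: \val p + s *: pure R j).
have segE s : 0 <= s <= 1 -> \val (seg s) = (1 - s) *: \val p + s *: pure R j.
  move=> s01; rewrite val_insubd ifT//; apply/mem_set.
  exact: simplex_segment (simplexP p) (simplex_pure j) s01.
have seg0 : seg 0 = p.
  by apply/val_inj; rewrite /= segE ?lexx ?ler01// subr0 scale1r scale0r addr0.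
have Useg s y : 0 <= s <= 1 -> utility u (\val (seg s)) y
    = (1 - s) * utility u (\val p) y + s * u (j, y).
  move=> s01.
  by rewrite segE// !utilityE weighted_sum_segment weighted_sum_pure.
have Cseg b : exists c, forall s, 0 <= s <= 1 ->
    C b (seg s) = (1 - s) * C b p + s * c.
  have [V [w CE]] := continuation_affine b.
  exists (V + w j) => s s01.
  by rewrite !CE segE// weighted_sum_segment weighted_sum_pure; ring.
have worth_seg s : 0 <= s <= 1 ->
    worth p + s * (u (j, x) - worth p) <= worth (seg s).
  move=> s01; have := utility_le_worth (seg s) x.
  rewrite Useg// (zstar_worth xp); lra.
rewrite (zstar_worth xp) in gain.
(* [cp] is the value of [C (phi p)] at [pure R j]. Keeping the action [x] and the continuation from
   [phi p] gives the lower bound on the quotients of [g]. *)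
have [cp Cp] := Cseg (phi p).
pose g s := lambda * worth (seg s) + delta * value (seg s).
apply: (@halving_absurd _ g ((1 - lambda) * (u (j, x) - worth p))
  (lambda * (u (j, x) - worth p) + delta * (cp - value p))).
- by rewrite mulr_gt0// subr_gt0.
- move=> s /andP[s0 s1].
  have s01 : 0 <= s <= 1 by lra.
  have s201 : 0 <= 2 * s <= 1 by lra.
  have stepE := continuation_step (seg s) p.
  have [c Cs] := Cseg (phi (seg s)).
  have C1 := Cs _ s01; have C2 := Cs _ s201.
  have V2 := continuation_le_value (phi (seg s)) (seg (2 * s)).
  have Vs : value (seg s) = C (phi (seg s)) (seg s) by [].
  have Vp := continuation_le_value (seg s) p.
  have U1 := Useg s (z (seg s)) s01; have U2 := Useg _ (z (seg s)) s201.
  have W2 := utility_le_worth (seg (2 * s)) (z (seg s)).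
  have W1 := worth_seg _ s01.
  rewrite /flow_payoff -/(worth (seg s)) in stepE.
  rewrite -/(worth (seg s)) in U1.
  rewrite /g seg0.
  have C0 : C (phi (seg s)) p >= 2 * value (seg s) - value (seg (2 * s)) by lra.
  have U0 : utility u (\val p) (z (seg s)) >=
      2 * worth (seg s) - worth (seg (2 * s)).
    lra.
  have := ler_wpM2l (ltW d0) C0; have := ler_wpM2l (ltW l0) U0.
  have l1' : 0 <= 1 - lambda by lra.
  have := ler_wpM2l l1' W1.
  (* The deviation to [seg s] does not pay at [p], and [stay] bounds
     [value p - (1 - lambda) * worth p] by [g 0]. *)
  rewrite stepE in Vp; lra.
- move=> s s01; rewrite /g seg0.
  have V := continuation_le_value (phi p) (seg s).
  rewrite Cp// -/(value p) in V.
  have := ler_wpM2l (ltW d0) V.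
  have := ler_wpM2l (ltW l0) (worth_seg s s01); lra.
Qed.

(** * Accumulation points of an equilibrium path *)

Section Path.
Context (a : nat -> simplex R n) (a_path : forall t, a t.+1 = phi (a t)).
Implicit Types p q : simplex R n.

Lemma accumulation_closed (p : 'rV[R]_n) (A : set 'rV[R]_n) :
  accumulation_point a p -> closed A -> (\forall t \near \oo, A (\val (a t))) ->
  A p.
Proof.
exact: cluster_closed.
Qed.

Lemma accumulation_simplex (p : 'rV[R]_n) :
  accumulation_point a p -> simplex R n p.
Proof.
move=> ap; apply: accumulation_closed ap simplex_closed _.
by apply: nearW => t; exact: simplexP.
Qed.

Lemma path_worth_nondecreasing s t : (s <= t)%N -> worth (a s) <= worth (a t).
Proof.
elim: t => [|t IH]; first by rewrite leqn0 => /eqP ->.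
rewrite leq_eqVlt => /predU1P[->//|st].
by rewrite (le_trans (IH st))// a_path worth_nondecreasing.
Qed.

(** The action varies along the path, so the closed set is a finite union over [X]; it contains the
    path from time [t] on. *)
Lemma path_worth_le_accumulation p t :
  accumulation_point a (\val p) -> worth (a t) <= worth p.
Proof.
move=> ap.
have [x _] : (\bigcup_(x in [set: X]) [set v | worth (a t) <= utility u v x])
    (\val p).
  apply: accumulation_closed ap _ _.
    apply: closed_bigcup => [|x _]; first exact: finite_finset.
    exact: closed_weighted_sum_ge.
  exists t => // s /path_worth_nondecreasing ts; exists (z (a s)) => //.
by move=> /= /le_trans; apply; exact: utility_le_worth.
Qed.

(** Applied both ways, it makes [worth] constant on the accumulation points. *)
Lemma accumulation_worth_le p q : accumulation_point a (\val p) ->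
  accumulation_point a (\val q) -> worth p <= worth q.
Proof.
move=> ap aq.
apply: (accumulation_closed
  (A := [set v | utility u v (z p) <= worth q])) ap _ _.
  exact: closed_weighted_sum_le.
apply: nearW => t; apply: le_trans (utility_le_worth _ _) _.
exact: path_worth_le_accumulation.
Qed.

(** The start [phi p] is frozen and only the evaluator runs along the path:
    [C (phi p) (a t) <= value (a t)] is controlled by [worth (a t.+1) <= worth p], and affinity
    carries the bound to [p]. *)
Lemma accumulation_stay_optimal p : accumulation_point a (\val p) ->
  (1 - delta) * value p <= worth p.
Proof.
move=> ap; have [V [w CE]] := continuation_affine (phi p).
have /andP[d0 d1] := delta01.
have d1' : 0 < 1 - delta by rewrite subr_gt0.
rewrite -ler_pdivlMl// /value CE -lerBrDl.
apply: (accumulation_closed (A := [set v | weighted_sum w v <= _])) (ap) _ _.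
  exact: closed_weighted_sum_le.
apply: nearW => t /=; rewrite lerBrDl -CE ler_pdivlMl//.
apply: (le_trans (ler_wpM2l (ltW d1') (continuation_le_value _ _))).
apply: le_trans (value_le_worth _) _.
by rewrite -a_path; exact: path_worth_le_accumulation.
Qed.

Lemma accumulation_argmax (p : 'rV[R]_n) x : accumulation_point a p ->
  x \in zstar u p -> forall j, u (j, x) <= utility u p x.
Proof.
move=> ap; have sp := accumulation_simplex ap.
pose p' : simplex R n := exist _ p (mem_set sp).
move=> xp; apply: (stay_optimal_argmax (p := p')) => //.
exact: accumulation_stay_optimal.
Qed.

(** Clustering along the times in [B] implies clustering along all times. [B] will select the exits
    from a ball. *)
Lemma accumulation_successor (B : set nat) (p q : 'rV[R]_n) :
  cluster ((fun t => (\val (a t), \val (a t.+1))) @ within B \oo) (p, q) ->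
  accumulation_point a p /\ accumulation_point a q.
Proof.
move=> pq; split=> V W [N _ NV] pW.
  have [] := pq (V `*` setT) (W `*` setT).
  - by exists N => // t Nt _; split=> //; exact: NV.
  - by exists (W, setT); [split=> //; exact: filterT|].
  by move=> [b c] [[Vb _] [Wb _]]; exists b.
have [] := pq (setT `*` V) (setT `*` W).
- by exists N => // t Nt _; split=> //; apply: NV; exact: leqW.
- by exists (setT, W); [split=> //; exact: filterT|].
by move=> [b c] [[_ Vc] [_ Wc]]; exists c.
Qed.

(* In the limit along the steps of the path the inequality
   [worth p <= (1 - lambda) * U (q, x) + lambda * U (p, x)], where
   [worth p = worth q], forces [x] to be optimal at both [p] and [q], hence both
   to be the pure worldview that likes [x] best. *)
Lemma accumulation_successor_eq (B : set nat) (p q : 'rV[R]_n) :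
  (forall x, injective (fun j => u (j, x))) ->
  cluster ((fun t => (\val (a t), \val (a t.+1))) @ within B \oo) (p, q) ->
  p = q.
Proof.
move=> u_inj pq; have [ap aq] := accumulation_successor pq.
have [/andP[l0 l1] _] := (lambda01, delta01).
have [sp sq] := (accumulation_simplex ap, accumulation_simplex aq).
pose p' : simplex R n := exist _ p (mem_set sp).
pose q' : simplex R n := exist _ q (mem_set sq).
(* The step inequality against every action [y], with the terms in the first point moved to the
   left; [x] is the action at the second point. *)
have [x _ xpq] : (\bigcup_(x in [set: X]) \bigcap_(y in [set: X])
    [set v | weighted_sum (fun j => u (j, y) - lambda * u (j, x)) v.1
             <= weighted_sum (fun j => (1 - lambda) * u (j, x)) v.2]) (p, q).
  apply: cluster_closed pq _ _.
    apply: closed_bigcup => [|x _]; first exact: finite_finset.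
    by apply: closed_bigI => y _; exact: closed_weighted_sum_pair.
  exists 0%N => // t _ _; exists (z (a t.+1)) => // y _ /=.
  rewrite weighted_sumB weighted_sumZ weighted_sumZ lerBlDr -!utilityE.
  apply: le_trans (utility_le_worth _ _) _.
  apply: le_trans (worth_le_value _) _.
  by rewrite a_path; exact: value_le_flow.
have wpq : worth p' = worth q'.
  by apply/le_anti; rewrite !accumulation_worth_le.
have /= := xpq (z p') I.
rewrite weighted_sumB !weighted_sumZ lerBlDr -!utilityE.
rewrite -[utility u p (z p')]/(worth p') => wp.
have xp := utility_le_worth p' x; have xq := utility_le_worth q' x.
rewrite /= in xp xq.
have Up : utility u p x = worth p' by apply/le_anti; rewrite xp/=; nra.
have Uq : utility u q x = worth q' by apply/le_anti; rewrite xq/=; nra.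
have zp : x \in zstar u p.
  by rewrite inE; apply/forallP => y; rewrite Up; exact: (utility_le_worth p').
have zq : x \in zstar u q.
  by rewrite inE; apply/forallP => y; rewrite Uq; exact: (utility_le_worth q').
have [i pi ui] := argmax_pure (@u_inj x) sp (accumulation_argmax ap zp).
have [j qj uj] := argmax_pure (@u_inj x) sq (accumulation_argmax aq zq).
rewrite pi qj; congr pure; apply: (u_inj x).
by rewrite [LHS]ui [RHS]uj [LHS]Up wpq -Uq.
Qed.

Lemma accumulation_pure (p : 'rV[R]_n) :
  (forall x, injective (fun j => u (j, x))) -> accumulation_point a p ->
  exists j, p = pure R j.
Proof.
move=> u_inj ap; have sp := accumulation_simplex ap.
pose p' : simplex R n := exist _ p (mem_set sp).
have [zp _] := mpe p'.
have [j pj _] := argmax_pure (@u_inj (z p')) sp (accumulation_argmax ap zp).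
by exists j.
Qed.

(** If the path left a small ball around a pure accumulation point infinitely often, the pairs of
    positions before and after an exit would cluster at some [(v, v)] with [v] pure, which is
    impossible. *)
Lemma injective_payoffs_converge :
  (forall x, injective (fun j => u (j, x))) -> converges_to_pure a.
Proof.
move=> u_inj.
have [p [_ ap]] :
    (simplex R n `&` cluster ((fun t => \val (a t)) @ \oo)) !=set0.
  apply: simplex_compact; exists 0%N => // t _; exact: simplexP.
have [j pj] := accumulation_pure u_inj ap; rewrite {}pj in ap.
exists j; apply/cvgrPdist_lt => e e0; apply: contrapT => far.
(* Radius at most 1/2, since distinct pure worldviews are at distance at least 1. *)
pose e' := Num.min e 2^-1.
have e'0 : 0 < e' by rewrite lt_min e0 invr_gt0 ltr0n.
pose near_j (v : 'rV[R]_n) := `|pure R j - v| < e'.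
pose B := [set t | near_j (\val (a t)) /\ ~ near_j (\val (a t.+1))].
(* After the last exit, any visit to the ball would be permanent, contrary to [far]. *)
have B_unbounded : ~ within B \oo set0.
  move=> [N _ noB]; apply: far.
  have [_ [[t0 Nt0 <-] at0]] : [set \val (a t) | t in [set t | (N <= t)%N]]
      `&` near_j !=set0.
    apply: ap; first by exists N => // t Nt; exists t.
    by have := nbhsx_ballx (pure R j) _ e'0; rewrite -ball_normE.
  have stay k : near_j (\val (a (t0 + k)%N)).
    elim: k => [|k IH]; first by rewrite addn0.
    rewrite addnS; apply: contrapT => leave.
    by apply: (noB (t0 + k)%N) => //=; exact: leq_trans Nt0 (leq_addr _ _).
  exists t0 => // t /= /subnKC <-.
  by apply: lt_le_trans (stay _) _; rewrite ge_min lexx.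
pose F := (fun t => (\val (a t), \val (a t.+1))) @ within B \oo.
have F_proper : ProperFilter F.
  by apply: fmap_proper_filter; apply: Build_ProperFilter.
have [[v w] [_ vw]] : (simplex R n `*` simplex R n) `&` cluster F !=set0.
  apply: (compact_setX simplex_compact simplex_compact).
  by exists 0%N => // t _ _; split; exact: simplexP.
have vw_eq := accumulation_successor_eq u_inj vw; rewrite -{w}vw_eq in vw.
have [av _] := accumulation_successor vw.
have [k vk] := accumulation_pure u_inj av; rewrite {v av}vk in vw.
have FB : F [set y | near_j y.1 /\ ~ near_j y.2] by exists 0%N.
have ball_k (d : R) : 0 < d -> nbhs (pure R k) [set v | `|pure R k - v| < d].
  by move=> d0; have := nbhsx_ballx (pure R k) _ d0; rewrite -ball_normE.
(* If [j = k], the positions after exits cannot avoid the ball; otherwise a position before an exit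
   is within 1/2 of two distinct pure worldviews. *)
have [jk|jk] := eqVneq j k.
  have [] := vw _ (setT `*` [set v | `|pure R k - v| < e']) FB.
    by exists (setT, [set v | `|pure R k - v| < e']); 
      [split; [exact: filterT|exact: ball_k]|].
  by move=> [b c] /= [[_ cj] [_ ck]]; apply: cj; rewrite /near_j jk.
have [] := vw _ ([set v | `|pure R k - v| < 2^-1] `*` setT) FB.
  by exists ([set v | `|pure R k - v| < 2^-1], setT);
    [split; [apply: ball_k; rewrite invr_gt0|exact: filterT]|].
move=> [b c] /= [[bj _] [bk _]].
have := norm_pureB (R := R) jk; rewrite leNgt => /negP; apply.
rewrite [1]splitr div1r; apply: le_lt_trans (ler_distD b _ _) _.
rewrite ltrD//; last by rewrite distrC.
by apply: lt_le_trans bj _; rewrite ge_min lexx orbT.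
Qed.

End Path.
End Equilibrium.

(** * Density of payoff arrays without ties *)

(** Adding [s] times the index of the worldview to its payoffs creates a given tie for one [s] only,
    so small nonzero [s] avoid all of the finitely many ties. *)
Lemma injective_payoffs_dense (R : realType) (n : nat) (X : finType)
    (u : {ptws 'I_n * X -> R}) (N : set {ptws 'I_n * X -> R}) :
  nbhs u N ->
  exists2 v, N v & forall x, injective (fun j => v (j, x)).
Proof.
move=> uN.
pose f (s : R) : {ptws 'I_n * X -> R} := fun jx => u jx + s * (jx.1 : nat)%:R.
have f_cvg : f s @[s --> 0^'] --> u.
  (* Convergence is checked coordinate by coordinate. *)
  apply/cvg_sup => jx.
  rewrite cvg_image; last first.
    by apply/seteqP; split=> // r _; exists (fun=> r).
  have fjx : f s jx @[s --> 0^'] --> u jx.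
    apply: cvg_within_filter.
    have : f s jx @[s --> 0] --> u jx + 0 * (jx.1 : nat)%:R.
      apply: cvgD; first exact: cvg_cst.
      by apply: cvgM; [exact: cvg_id|exact: cvg_cst].
    by rewrite mul0r addr0.
  move=> W /fjx jxW; exists ((fun g => g jx) @^-1` W) => //.
  by apply/seteqP; split=> [_ [g Wg <-]//|r Wr]; exists (fun=> r).
have f_inj : \forall s \near 0^', forall jx : ('I_n * 'I_n) * X,
    jx.1.1 != jx.1.2 -> f s (jx.1.1, jx.2) != f s (jx.1.2, jx.2).
  apply: filter_forall => -[[i j] x]/=.
  have [->|ij] := eqVneq i j; first by apply: nearW.
  have ij0 : (i : nat)%:R - (j : nat)%:R != 0 :> R.
    by rewrite subr_eq0 eqr_nat.
  pose s0 := (u (j, x) - u (i, x)) / ((i : nat)%:R - (j : nat)%:R).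
  have : \forall s \near 0^', s != s0.
    (* If [u] itself has this tie then [s0 = 0], which the punctured neighbourhood excludes. *)
    have [->|s00] := eqVneq s0 0; first exact: nbhs_dnbhs_neq.
    apply: cvg_within; have s0_gt0 : 0 < `|s0| by rewrite normr_gt0.
    apply: filterS (nbhsx_ballx 0 _ s0_gt0) => s.
    rewrite -ball_normE/= sub0r normrN.
    by apply: contraTneq => ->; rewrite ltxx.
  apply: filterS => s /eqP ss0 _; apply/eqP => /= fE; apply: ss0.
  rewrite /s0 -[s](mulfK ij0); congr (_ / _).
  move: fE; rewrite /f /=; lra.
have fN : \forall s \near 0^', N (f s) by exact: f_cvg.
have /(@filter_ex _ _ (Proper_dnbhs_numFieldType 0))[s [Ns s_inj]] :
    \forall s \near 0^', N (f s) /\ forall jx : ('I_n * 'I_n) * X,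
      jx.1.1 != jx.1.2 -> f s (jx.1.1, jx.2) != f s (jx.1.2, jx.2).
  exact: (filterI fN f_inj).
exists (f s) => // x i j /= fij; apply/eqP; apply: contraT => ij.
by have := s_inj ((i, j), x) ij; rewrite /= fij eqxx.
Qed.

(** * Mixed accumulation points and nongeneric payoffs *)

Theorem corollary6p4 (R : realType) (n : nat) (X : finType) (lambda delta : R)
    (n_gt0 : (0 < n)%N) (X_gt0 : (0 < #|X|)%N)
    (lambda01 : 0 < lambda < 1) (delta01 : 0 < delta < 1) :
  (forall (u : {ptws 'I_n * X -> R}) (a : nat -> simplex R n) (xs : nat -> X)
      (p : 'rV[R]_n),
    stationary_MPE_path lambda delta u a xs ->
    accumulation_point a p ->
    ~ (exists j : 'I_n, p = pure R j) ->
    forall x : X, x \in zstar u p ->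
      (2 <= #|argmax (fun j : 'I_n => u (j, x))|)%N /\
      forall i : 'I_n, 0 < p 0 i ->
        u (i, x) = \big[Order.max/u (i, x)]_(j < n) u (j, x)) /\
  interior (nonpure_payoffs n X lambda delta) = set0 /\
  nonpure_payoffs n X lambda delta `<=`
    \bigcup_(x in [set: X])
      \bigcup_(ij in [set ij : 'I_n * 'I_n | (ij.1 < ij.2)%N])
        [set u : {ptws 'I_n * X -> R} | u (ij.1, x) = u (ij.2, x)] /\
  ~ (exists O : set {ptws 'I_n * X -> R},
      open O /\ O !=set0 /\ O `<=` nonpure_payoffs n X lambda delta).
Proof.
have contained : nonpure_payoffs n X lambda delta `<=`
    \bigcup_(x in [set: X])
      \bigcup_(ij in [set ij : 'I_n * 'I_n | (ij.1 < ij.2)%N])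
        [set u : {ptws 'I_n * X -> R} | u (ij.1, x) = u (ij.2, x)].
  move=> u [a [xs [[phi [z [mpe path]]] not_pure]]]; apply: contrapT => no_tie.
  apply/not_pure/(injective_payoffs_converge lambda01 delta01 mpe).
    by move=> t; case: (path t).
  move=> x i j /= uij; apply/val_inj => /=.
  have [ij|ji|//] := ltngtP i j; exfalso; apply: no_tie.
    by exists x => //; exists (i, j).
  by exists x => //; exists (j, i).
(* A neighbourhood inside the set would contain an array without ties, against [contained]. *)
have no_interior : interior (nonpure_payoffs n X lambda delta)
    = set0 :> set {ptws 'I_n * X -> R}.
  apply/seteqP; split=> // u /injective_payoffs_dense [v /contained].
  by move=> [x _ [[i j] /= ij vij]] /(_ x _ _ vij) eij; rewrite eij ltnn in ij.
split; last do ?split=> //.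
  move=> u a xs p [phi [z [mpe path]]] ap mixed x xp.
  have a_path t : a t.+1 = phi (a t) by case: (path t).
  have umax := accumulation_argmax lambda01 delta01 mpe a_path ap xp.
  have sp := accumulation_simplex ap.
  have supp i : 0 < p 0 i -> u (i, x) = utility u p x.
    exact: support_argmax.
  have supp_argmax i : 0 < p 0 i -> i \in argmax (fun j : 'I_n => u (j, x)).
    by move=> ppos; rewrite inE; apply/forallP => j; rewrite (supp i ppos).
  split=> [|i ppos].
    (* A mixed [p] has two indices in its support, and both are maximizers. *)
    have [i ppos] := simplex_support sp; apply/card_gt1P.
    have [[k [ki pk]]|no_k] := pselect (exists k, k != i /\ 0 < p 0 k).
      by exists k, i; split=> //; exact: supp_argmax.
    case: mixed; exists i; apply: simplex_support1 sp _ => k pk.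
    by apply/eqP; apply: contraT => ki; case: no_k; exists k.
  (* The default [u (i, x)] is one of the terms, so the big maximum is the true one. *)
  apply/le_anti/andP; split; first exact: bigmax_ge_id.
  by apply: bigmax_le => // j _; rewrite (supp i ppos).
move=> [W [W_open [[u Wu] WN]]].
suff : interior (nonpure_payoffs n X lambda delta) u by rewrite no_interior.
by apply: filterS WN _; exact: open_nbhs_nbhs.
Qed.
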